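(* Let $\mathcal{L}$ be the free monoidal category with a family of locally monoidal endofunctors $\{E^i\mid i\in\mathcal{I}\}$ generated by a set of generating objects. Then the functor $G$ from $\mathcal{L}$ to the category $\mathit{Fun}$ of functions between finite ordinals is faithful; i.e. for all arrows $f,g:A\to B$ of $\mathcal{L}$, if $Gf=Gg$, then $f=g$ in $\mathcal{L}$.
   Context: A monoidal category is a category with a bifunctor $\otimes$, a unit object $I$, and natural isomorphisms with components $a_{A,B,C}:(A\otimes B)\otimes C\to A\otimes(B\otimes C)$, $l_A:I\otimes A\to A$, $r_A:A\otimes I\to A$, satisfying Mac Lane's coherence equations (pentagon and triangle). A locally monoidal endofunctor of a monoidal category is an endofunctor $E$ together with natural transformations $\psi^L_{A,B}:EA\otimes B\to E(A\otimes B)$ and $\psi^R_{A,B}:A\otimes EB\to E(A\otimes B)$ such that (1) $Ea_{A,B,C}\circ\psi^L_{A\otimes B,C}\circ(\psi^L_{A,B}\otimes\mathbf{1}_C)=\psi^L_{A,B\otimes C}\circ a_{EA,B,C}$; (2) $Er_A\circ\psi^L_{A,I}=r_{EA}$; (3) $Ea_{A,B,C}\circ\psi^R_{A\otimes B,C}=\psi^R_{A,B\otimes C}\circ(\mathbf{1}_A\otimes\psi^R_{B,C})\circ a_{A,B,EC}$; (4) $El_A\circ\psi^R_{I,A}=l_{EA}$; (5) $Ea_{A,B,C}\circ\psi^L_{A\otimes B,C}\circ(\psi^R_{A,B}\otimes\mathbf{1}_C)=\psi^R_{A,B\otimes C}\circ(\mathbf{1}_A\otimes\psi^L_{B,C})\circ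 a_{A,EB,C}$. The category $\mathcal{L}$: fix two arbitrary sets, one of generating objects (propositional letters) and one of generating functors $\{E^i\mid i\in\mathcal{I}\}$. Objects are the formulae built from the letters and the constant $I$ with the binary connective $\otimes$ and the unary connectives $E^i$. Arrows are equivalence classes of arrow terms built from $\mathbf{1}_A$, $a_{A,B,C}$, $l_A$, $r_A$, the inverses of $a,l,r$, and $\psi^{L,i}_{A,B}$, $\psi^{R,i}_{A,B}$ (for each $i\in\mathcal{I}$) with the operations $\circ$, $\otimes$ and $E^i$, modulo the smallest congruence for which the equations of monoidal categories hold and each $(E^i,\psi^{L,i},\psi^{R,i})$ is a locally monoidal endofunctor. Superscripts $i$ are omitted below. The functor $G$: $\mathit{Fun}$ has as objects the finite ordinals $n=\{0,\dots,n-1\}$ and as arrows all functions. $GA$ is the number of occurrences of the generating functors $E^i$ (for all $i$ together) in $A$, numbered $0,1,\dots$ from left to right. $G$ of $\mathbf{1}$, $a$, $l$, $r$ (and inverses) and of $\psi^L_{A,B}$ is an identity function; $G\psi^R_{A,B}:GA+1+GB\to 1+GA+GB$ maps $k\mapsto 1+k$ for $k<GA$, $GA\mapsto 0$, and $GA+1+k\mapsto GA+1+k$ for $k<GB$; $G(f\otimes g)$ is $Gf$ and $Gg$ placed side by side (disjoint sum); $GEf$ maps $0\mapsto 0$ and $1+k\mapsto 1+(Gf)(k)$; $G(g\circ f)=Gg\circ Gf$. *)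

(* Defs.v *)
From mathcomp Require Import all_boot.
From Stdlib Require Import RelationClasses.

Set Implicit Arguments.
Unset Strict Implicit.
Unset Printing Implicit Defensive.

(** Equality of arrows is an equivalence relation [eqv] on each hom type, so
    that a category whose arrows are equivalence classes of terms can be given
    by the terms and the relation. *)
Record category := Category {
  obj :> Type;
  hom : obj -> obj -> Type;
  eqv : forall A B, hom A B -> hom A B -> Prop;
  ide : forall A, hom A A;
  comp : forall A B C, hom B C -> hom A B -> hom A C;
  eqv_equivalence : forall A B, Equivalence (@eqv A B);
  comp_eqv : forall A B C (g g' : hom B C) (f f' : hom A B),
    eqv g g' -> eqv f f' -> eqv (comp g f) (comp g' f');
  comp_ide_l : forall A B (f : hom A B), eqv (comp (ide B) f) f;
  comp_ide_r : forall A B (f : hom A B), eqv (comp f (ide A)) f;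
  comp_assoc : forall A B C D (h : hom C D) (g : hom B C) (f : hom A B),
    eqv (comp (comp h g) f) (comp h (comp g f))
}.

Record functor (C D : category) := Functor {
  fobj :> C -> D;
  fmap : forall A B : C, hom A B -> hom (fobj A) (fobj B);
  fmap_eqv : forall (A B : C) (f g : hom A B),
    eqv f g -> eqv (fmap f) (fmap g);
  fmap_ide : forall A : C, eqv (fmap (ide A)) (ide (fobj A));
  fmap_comp : forall (X Y Z : C) (g : hom Y Z) (f : hom X Y),
    eqv (fmap (comp g f)) (comp (fmap g) (fmap f))
}.

Definition faithful (C D : category) (F : functor C D) : Prop :=
  forall (A B : C) (f g : hom A B), eqv (fmap F f) (fmap F g) -> eqv f g.

Inductive formula (letter index : Type) : Type :=
  | Letter of letter
  | Unit
  | Tensor of formula letter index & formula letter index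
  | Ap of index & formula letter index.

Arguments Letter {letter index}.
Arguments Unit {letter index}.

Declare Scope formula_scope.
Delimit Scope formula_scope with form.
Bind Scope formula_scope with formula.
Notation "A ⊗ B" := (Tensor A B) (at level 40, left associativity)
  : formula_scope.

Inductive term (letter index : Type) :
    formula letter index -> formula letter index -> Type :=
  | Id A : term A A
  | Assoc A B C : term ((A ⊗ B) ⊗ C) (A ⊗ (B ⊗ C))
  | AssocV A B C : term (A ⊗ (B ⊗ C)) ((A ⊗ B) ⊗ C)
  | UnitL A : term (Unit ⊗ A) A
  | UnitLV A : term A (Unit ⊗ A)
  | UnitR A : term (A ⊗ Unit) A
  | UnitRV A : term A (A ⊗ Unit)
  | PsiL i A B : term (Ap i A ⊗ B) (Ap i (A ⊗ B))
  | PsiR i A B : term (A ⊗ Ap i B) (Ap i (A ⊗ B))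
  | Comp A B C : term B C -> term A B -> term A C
  | TensorMap A A' B B' : term A A' -> term B B' -> term (A ⊗ B) (A' ⊗ B')
  | ApMap i A B : term A B -> term (Ap i A) (Ap i B).

Arguments Id {letter index}.
Arguments Assoc {letter index}.
Arguments AssocV {letter index}.
Arguments UnitL {letter index}.
Arguments UnitLV {letter index}.
Arguments UnitR {letter index}.
Arguments UnitRV {letter index}.
Arguments PsiL {letter index}.
Arguments PsiR {letter index}.

Declare Scope term_scope.
Delimit Scope term_scope with term.
Bind Scope term_scope with term.
Notation "g ∘ f" := (Comp g f) (at level 40, left associativity) : term_scope.
Notation "f ⊗ g" := (TensorMap f g) (at level 40, left associativity)
  : term_scope.

(** Arrows of [L] are terms up to [≡], the smallest congruence containing the
    equations of monoidal categories and of locally monoidal endofunctors. *)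
Reserved Notation "f ≡ g" (at level 70, no associativity).

Inductive term_eq (letter index : Type) :
    forall A B : formula letter index, term A B -> term A B -> Prop :=
  | eq_refl_ A B (f : term A B) : f ≡ f
  | eq_sym_ A B (f g : term A B) : f ≡ g -> g ≡ f
  | eq_trans_ A B (f g h : term A B) : f ≡ g -> g ≡ h -> f ≡ h
  | eq_comp A B C (g g' : term B C) (f f' : term A B) :
      g ≡ g' -> f ≡ f' -> g ∘ f ≡ g' ∘ f'
  | eq_tensor A A' B B' (f f' : term A A') (g g' : term B B') :
      f ≡ f' -> g ≡ g' -> f ⊗ g ≡ f' ⊗ g'
  | eq_ap i A B (f f' : term A B) : f ≡ f' -> ApMap i f ≡ ApMap i f'
  | eq_id_l A B (f : term A B) : Id B ∘ f ≡ f
  | eq_id_r A B (f : term A B) : f ∘ Id A ≡ f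
  | eq_assoc A B C D (h : term C D) (g : term B C) (f : term A B) :
      (h ∘ g) ∘ f ≡ h ∘ (g ∘ f)
  | eq_tensor_id A B : Id A ⊗ Id B ≡ Id (A ⊗ B)
  | eq_tensor_comp A A' A'' B B' B'' (f' : term A' A'') (f : term A A')
        (g' : term B' B'') (g : term B B') :
      (f' ∘ f) ⊗ (g' ∘ g) ≡ (f' ⊗ g') ∘ (f ⊗ g)
  | eq_a_nat A A' B B' C C' (f : term A A') (g : term B B') (h : term C C') :
      Assoc A' B' C' ∘ ((f ⊗ g) ⊗ h) ≡ (f ⊗ (g ⊗ h)) ∘ Assoc A B C
  | eq_l_nat A A' (f : term A A') : UnitL A' ∘ (Id Unit ⊗ f) ≡ f ∘ UnitL A
  | eq_r_nat A A' (f : term A A') : UnitR A' ∘ (f ⊗ Id Unit) ≡ f ∘ UnitR A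
  | eq_a_V A B C : Assoc A B C ∘ AssocV A B C ≡ Id _
  | eq_V_a A B C : AssocV A B C ∘ Assoc A B C ≡ Id _
  | eq_l_V A : UnitL A ∘ UnitLV A ≡ Id _
  | eq_V_l A : UnitLV A ∘ UnitL A ≡ Id _
  | eq_r_V A : UnitR A ∘ UnitRV A ≡ Id _
  | eq_V_r A : UnitRV A ∘ UnitR A ≡ Id _
  | eq_pentagon A B C D :
      Assoc A B (C ⊗ D) ∘ Assoc (A ⊗ B) C D
      ≡ (Id A ⊗ Assoc B C D) ∘ Assoc A (B ⊗ C) D ∘ (Assoc A B C ⊗ Id D)
  | eq_triangle A B : (Id A ⊗ UnitL B) ∘ Assoc A Unit B ≡ UnitR A ⊗ Id B
  | eq_ap_id i A : ApMap i (Id A) ≡ Id (Ap i A)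
  | eq_ap_comp i A B C (g : term B C) (f : term A B) :
      ApMap i (g ∘ f) ≡ ApMap i g ∘ ApMap i f
  | eq_psiL_nat i A A' B B' (f : term A A') (g : term B B') :
      PsiL i A' B' ∘ (ApMap i f ⊗ g) ≡ ApMap i (f ⊗ g) ∘ PsiL i A B
  | eq_psiR_nat i A A' B B' (f : term A A') (g : term B B') :
      PsiR i A' B' ∘ (f ⊗ ApMap i g) ≡ ApMap i (f ⊗ g) ∘ PsiR i A B
  | eq_psiL_a i A B C :
      ApMap i (Assoc A B C) ∘ PsiL i (A ⊗ B) C ∘ (PsiL i A B ⊗ Id C)
      ≡ PsiL i A (B ⊗ C) ∘ Assoc (Ap i A) B C
  | eq_psiL_r i A : ApMap i (UnitR A) ∘ PsiL i A Unit ≡ UnitR (Ap i A)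
  | eq_psiR_a i A B C :
      ApMap i (Assoc A B C) ∘ PsiR i (A ⊗ B) C
      ≡ PsiR i A (B ⊗ C) ∘ (Id A ⊗ PsiR i B C) ∘ Assoc A B (Ap i C)
  | eq_psiR_l i A : ApMap i (UnitL A) ∘ PsiR i Unit A ≡ UnitL (Ap i A)
  | eq_psi_a i A B C :
      ApMap i (Assoc A B C) ∘ PsiL i (A ⊗ B) C ∘ (PsiR i A B ⊗ Id C)
      ≡ PsiR i A (B ⊗ C) ∘ (Id A ⊗ PsiL i B C) ∘ Assoc A (Ap i B) C
where "f ≡ g" := (term_eq f%term g%term).

Lemma term_eq_equivalence (letter index : Type) (A B : formula letter index) :
  Equivalence (@term_eq letter index A B).
Proof.
split; [exact: eq_refl_ | exact: eq_sym_ | exact: eq_trans_].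
Qed.

Definition L (letter index : Type) : category :=
  @Category (formula letter index) (@term letter index) (@term_eq letter index)
    Id (@Comp letter index) (@term_eq_equivalence letter index)
    (@eq_comp letter index) (@eq_id_l letter index) (@eq_id_r letter index)
    (@eq_assoc letter index).

Definition fun_id (n : nat) : {ffun 'I_n -> 'I_n} := [ffun k => k].

Definition fun_comp (m n p : nat) (g : {ffun 'I_n -> 'I_p})
    (f : {ffun 'I_m -> 'I_n}) : {ffun 'I_m -> 'I_p} := [ffun k => g (f k)].

Lemma eq_equivalence_ (T : Type) : Equivalence (@eq T).
Proof. by split=> [x|x y ->|x y z -> ->]. Qed.

Definition Fun : category.
Proof.
refine (@Category nat (fun m n => {ffun 'I_m -> 'I_n}) (fun _ _ => eq)
  fun_id fun_comp (fun _ _ => eq_equivalence_ _) _ _ _ _).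
- by move=> A B C g g' f f' -> ->.
- by move=> A B f; apply/ffunP => k; rewrite !ffunE.
- by move=> A B f; apply/ffunP => k; rewrite !ffunE.
- by move=> A B C D h g f; apply/ffunP => k; rewrite !ffunE.
Defined.

(** The identity function between two propositionally equal ordinals. *)
Definition fun_cast (m n : nat) (e : m = n) : {ffun 'I_m -> 'I_n} :=
  [ffun k => cast_ord e k].

Definition fun_sum (m m' n n' : nat) (f : {ffun 'I_m -> 'I_m'})
    (g : {ffun 'I_n -> 'I_n'}) : {ffun 'I_(m + n) -> 'I_(m' + n')} :=
  [ffun k => match split k with
             | inl i => lshift n' (f i)
             | inr j => rshift m' (g j)
             end].

(** [0] goes to [0] and [1 + k] to [1 + f k]. *)
Definition fun_succ (m n : nat) (f : {ffun 'I_m -> 'I_n}) :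
    {ffun 'I_m.+1 -> 'I_n.+1} :=
  [ffun k => if unlift ord0 k is Some j then lift ord0 (f j) else ord0].

(** [k] goes to [1 + k] for [k < m], [m] goes to [0], and [m + 1 + k] is
    fixed; see [fun_psiR_val]. *)
Definition fun_psiR (m n : nat) : {ffun 'I_(m + n.+1) -> 'I_(m + n).+1} :=
  [ffun k => match split k with
             | inl i => lift ord0 (lshift n i)
             | inr j =>
                 if unlift ord0 j is Some j' then lift ord0 (rshift m j')
                 else ord0
             end].

Fixpoint Gobj (letter index : Type) (A : formula letter index) : nat :=
  match A with
  | Letter _ => 0
  | Unit => 0
  | Tensor B C => Gobj B + Gobj C
  | Ap _ B => (Gobj B).+1
  end.

Fixpoint Gmap (letter index : Type) (A B : formula letter index)
    (f : term A B) : {ffun 'I_(Gobj A) -> 'I_(Gobj B)} :=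
  match f in term A B return {ffun 'I_(Gobj A) -> 'I_(Gobj B)} with
  | Id A => fun_id (Gobj A)
  | Assoc A B C => fun_cast (esym (addnA (Gobj A) (Gobj B) (Gobj C)))
  | AssocV A B C => fun_cast (addnA (Gobj A) (Gobj B) (Gobj C))
  | UnitL A => fun_cast (add0n (Gobj A))
  | UnitLV A => fun_cast (esym (add0n (Gobj A)))
  | UnitR A => fun_cast (addn0 (Gobj A))
  | UnitRV A => fun_cast (esym (addn0 (Gobj A)))
  | PsiL _ A B => fun_cast (addSn (Gobj A) (Gobj B))
  | PsiR _ A B => fun_psiR (Gobj A) (Gobj B)
  | Comp _ _ _ g f => fun_comp (Gmap g) (Gmap f)
  | TensorMap _ _ _ _ f g => fun_sum (Gmap f) (Gmap g)
  | ApMap _ _ _ f => fun_succ (Gmap f)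
  end.

Lemma fun_psiR_val (m n : nat) (k : 'I_(m + n.+1)) :
  fun_psiR m n k = (if k < m then k.+1 else if k == m :> nat then 0 else k)
    :> nat.
Proof.
rewrite ffunE; case: splitP => i ki; rewrite ki.
  by rewrite lift0.
case: unliftP => [j|] ij; rewrite ij ?lift0 /= ?lift0.
  by rewrite -[X in _ == X]addn0 eqn_add2l addnS.
by rewrite addn0 eqxx.
Qed.

Lemma fun_psiR_lshift (m n : nat) (i : 'I_m) :
  fun_psiR m n (lshift n.+1 i) = lift ord0 (lshift n i).
Proof. by rewrite ffunE (unsplitK (inl i)). Qed.

Lemma fun_psiR_rshift0 (m n : nat) :
  fun_psiR m n (rshift m ord0) = ord0.
Proof. by rewrite ffunE (unsplitK (inr ord0)) unlift_none. Qed.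

Lemma fun_psiR_rshiftS (m n : nat) (j : 'I_n) :
  fun_psiR m n (rshift m (lift ord0 j)) = lift ord0 (rshift m j).
Proof. by rewrite ffunE (unsplitK (inr (lift ord0 j))) liftK. Qed.

Lemma fun_sum_lshift (m m' n n' : nat) (f : {ffun 'I_m -> 'I_m'})
    (g : {ffun 'I_n -> 'I_n'}) (i : 'I_m) :
  fun_sum f g (lshift n i) = lshift n' (f i).
Proof. by rewrite ffunE (unsplitK (inl i)). Qed.

Lemma fun_sum_rshift (m m' n n' : nat) (f : {ffun 'I_m -> 'I_m'})
    (g : {ffun 'I_n -> 'I_n'}) (j : 'I_n) :
  fun_sum f g (rshift m j) = rshift m' (g j).
Proof. by rewrite ffunE (unsplitK (inr j)). Qed.

Lemma fun_succ0 (m n : nat) (f : {ffun 'I_m -> 'I_n}) :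
  fun_succ f ord0 = ord0.
Proof. by rewrite ffunE unlift_none. Qed.

Lemma fun_succS (m n : nat) (f : {ffun 'I_m -> 'I_n}) (j : 'I_m) :
  fun_succ f (lift ord0 j) = lift ord0 (f j).
Proof. by rewrite ffunE liftK. Qed.

Lemma fun_compE (m n p : nat) (g : {ffun 'I_n -> 'I_p})
    (f : {ffun 'I_m -> 'I_n}) (k : 'I_m) : fun_comp g f k = g (f k).
Proof. by rewrite ffunE. Qed.

Lemma fun_idE (n : nat) (k : 'I_n) : fun_id n k = k.
Proof. by rewrite ffunE. Qed.

Lemma fun_castE (m n : nat) (e : m = n) (k : 'I_m) :
  fun_cast e k = cast_ord e k.
Proof. by rewrite ffunE. Qed.

Lemma cast_assoc1 (a b c : nat) e (i : 'I_a) :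
  cast_ord e (lshift c (lshift b i)) = lshift (b + c) i.
Proof. exact: ord_inj. Qed.

Lemma cast_assoc2 (a b c : nat) e (i : 'I_b) :
  cast_ord e (lshift c (rshift a i)) = rshift a (lshift c i).
Proof. exact: ord_inj. Qed.

Lemma cast_assoc3 (a b c : nat) e (i : 'I_c) :
  cast_ord e (rshift (a + b) i) = rshift a (rshift b i).
Proof. by apply: ord_inj; rewrite /= addnA. Qed.

Lemma cast_add0n (a : nat) e (i : 'I_a) : cast_ord e (rshift 0 i) = i.
Proof. exact: ord_inj. Qed.

Lemma cast_addn0 (a : nat) e (i : 'I_a) : cast_ord e (lshift 0 i) = i.
Proof. exact: ord_inj. Qed.

Lemma cast_addSn0 (a b : nat) e :
  cast_ord e (lshift b (ord0 : 'I_a.+1)) = ord0 :> 'I_(a + b).+1.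
Proof. exact: ord_inj. Qed.

Lemma cast_addSnS (a b : nat) e (i : 'I_a) :
  cast_ord e (lshift b (lift ord0 i)) = lift ord0 (lshift b i)
    :> 'I_(a + b).+1.
Proof. exact: ord_inj. Qed.

Lemma cast_addSnR (a b : nat) e (i : 'I_b) :
  cast_ord e (rshift a.+1 i) = lift ord0 (rshift a i) :> 'I_(a + b).+1.
Proof. exact: ord_inj. Qed.

Definition fun_simpl := (fun_compE, fun_idE, fun_castE, fun_sum_lshift,
  fun_sum_rshift, fun_succ0, fun_succS, fun_psiR_lshift, fun_psiR_rshift0,
  fun_psiR_rshiftS, cast_assoc1, cast_assoc2, cast_assoc3, cast_add0n,
  cast_addn0, cast_addSn0, cast_addSnS, cast_addSnR).

Ltac split_ord k :=
  match type of k with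
  | 'I_(0) => by case: k
  | 'I_(?m.+1) =>
      case: (unliftP ord0 k) => [{}k ->|->]; [split_ord k | idtac]
  | 'I_(?m + ?n) =>
      case: (split_ordP k) => {}k ->; split_ord k
  | _ => idtac
  end.

Lemma Gmap_eqv (letter index : Type) (A B : formula letter index)
    (f g : term A B) : term_eq f g -> Gmap f = Gmap g.
Proof.
elim=> {A B f g} /=; try by [].
all: try by move=> *; congruence.
all: intros; apply/ffunP => k; cbn in k; split_ord k; rewrite ?fun_simpl.
all: try by [].
all: try by apply: ord_inj; rewrite /= ?addnA ?addn0.
Qed.

Definition G (letter index : Type) : functor (L letter index) Fun :=
  @Functor (L letter index) Fun (@Gobj letter index) (@Gmap letter index)
    (@Gmap_eqv letter index) (fun _ => erefl) (fun _ _ _ _ _ => erefl).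

(* Main.v *)
From mathcomp Require Import all_boot.
From Stdlib Require Import Setoid Morphisms ProofIrrelevance.
Require Import Defs.

(** Read a formula as a planar forest: letters and functors [E] are its nodes,
    and [ψ] lets a functor swallow a neighbour to its right ([PsiL]) or to its
    left ([PsiR]). The function [Gmap f] says which functor of the source
    becomes which functor of the target, and faithfulness is an induction on
    the target [B] of [f] that recovers [f] from this information.

    - If [B] contains no functor, then neither does any formula that [f] passes
      through, so [f] is built from the structural isomorphisms of monoidal
      categories alone, and any two such arrows are equal by Mac Lane's theorem
      ([coherence]).
    - If [B = E B'], let [k] be the functor of the source that [Gmap f] sends
      to the outermost [E]. No functor ever leaves the scope of another, so [k]
      has no functor above it, and there is an arrow [s] that lets [k] swallow
      everything else. This arrow is natural in the source
      ([term_pull_natural]); at a target whose [k] is already outermost it is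
      the identity, and naturality reads [f ≡ E f' ∘ s]. Since [s] depends on
      [k] only, two arrows with the same image under [G] factor through the
      same [s] ([ap_factor]).
    - If [B = B1 ⊗ B2], no swallowing ever crosses the cut between [B1] and
      [B2], so [f ≡ (f1 ⊗ f2) ∘ c] for a structural isomorphism [c] of the
      source onto a tensor product ([term_cuts]). The number of nodes is
      invariant under all arrows ([weight_term]), hence the place where [c]
      cuts the source depends only on [B1] and [B2] ([prefix_weight]).

    In the last two cases the common right factor is cancelled under [G],
    whose values are surjections ([Gmap_surj]), and the induction hypothesis
    applies to what remains. *)

Set Implicit Arguments.
Unset Strict Implicit.
Unset Printing Implicit Defensive.

Section Faithful.

Variables letter index : Type.

Local Notation formula := (formula letter index).
Local Notation term := (@term letter index).

Local Open Scope term_scope.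

Implicit Types A B C D : formula.

(** * Rewriting with equality of arrows *)

#[local] Instance term_eq_Equivalence A B :
  Equivalence (@term_eq letter index A B) := @term_eq_equivalence _ _ A B.

#[local] Hint Resolve eq_refl_ : core.

#[local] Instance Comp_Proper A B C :
  Proper (@term_eq letter index B C ==> @term_eq letter index A B ==>
          @term_eq letter index A C) (@Comp letter index A B C).
Proof. by move=> g g' eg f f' ef; exact: eq_comp. Qed.

#[local] Instance TensorMap_Proper A A' B B' :
  Proper (@term_eq letter index A A' ==> @term_eq letter index B B' ==>
          @term_eq letter index (A ⊗ B) (A' ⊗ B'))
    (@TensorMap letter index A A' B B').
Proof. by move=> f f' ef g g' eg; exact: eq_tensor. Qed.

#[local] Instance ApMap_Proper i A B :
  Proper (@term_eq letter index A B ==>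
          @term_eq letter index (Ap i A) (Ap i B)) (@ApMap letter index i A B).
Proof. by move=> f f' ef; exact: eq_ap. Qed.

Lemma comp_pre A B C D (g : term B C) (f : term A B) (h : term A C)
    (k : term D A) :
  g ∘ f ≡ h -> g ∘ (f ∘ k) ≡ h ∘ k.
Proof. by move=> e; rewrite -e eq_assoc. Qed.

Lemma comp_cancel A B C (g : term B A) (f : term A B) (k : term C A) :
  g ∘ f ≡ Id A -> g ∘ (f ∘ k) ≡ k.
Proof. by move=> e; rewrite (comp_pre _ e) eq_id_l. Qed.

Lemma epi_cancel A B C (f f' : term B C) (g : term A B) (gV : term B A) :
  g ∘ gV ≡ Id B -> f ∘ g ≡ f' ∘ g -> f ≡ f'.
Proof.
by move=> gK e; rewrite -[f]eq_id_r -[f']eq_id_r -gK -!eq_assoc e.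
Qed.

Lemma tensor_lr A A' B B' (f : term A A') (g : term B B') :
  (f ⊗ Id B') ∘ (Id A ⊗ g) ≡ f ⊗ g.
Proof. by rewrite -eq_tensor_comp eq_id_l eq_id_r. Qed.

Lemma tensor_compl A A' A'' B (f' : term A' A'') (f : term A A') :
  (f' ⊗ Id B) ∘ (f ⊗ Id B) ≡ (f' ∘ f) ⊗ Id B.
Proof. by rewrite -eq_tensor_comp eq_id_l. Qed.

Lemma tensor_compr A B B' B'' (g' : term B' B'') (g : term B B') :
  (Id A ⊗ g') ∘ (Id A ⊗ g) ≡ Id A ⊗ (g' ∘ g).
Proof. by rewrite -eq_tensor_comp eq_id_l. Qed.

Lemma aV_nat A A' B B' C C' (f : term A A') (g : term B B') (h : term C C') :
  AssocV A' B' C' ∘ (f ⊗ (g ⊗ h)) ≡ ((f ⊗ g) ⊗ h) ∘ AssocV A B C.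
Proof.
rewrite -[X in X ≡ _]eq_id_r -(eq_a_V A B C) -eq_assoc.
rewrite [_ ∘ _ ∘ Assoc _ _ _]eq_assoc.
by rewrite -eq_a_nat (comp_cancel _ (eq_V_a _ _ _)).
Qed.

Lemma lV_nat A B (f : term A B) : UnitLV B ∘ f ≡ (Id Unit ⊗ f) ∘ UnitLV A.
Proof.
apply: (epi_cancel (eq_l_V A)); rewrite !eq_assoc -eq_l_nat.
by rewrite (comp_cancel _ (eq_V_l _)) eq_V_l eq_id_r.
Qed.

Lemma rV_nat A B (f : term A B) : UnitRV B ∘ f ≡ (f ⊗ Id Unit) ∘ UnitRV A.
Proof.
apply: (epi_cancel (eq_r_V A)); rewrite !eq_assoc -eq_r_nat.
by rewrite (comp_cancel _ (eq_V_r _)) eq_V_r eq_id_r.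
Qed.

Lemma unit_tensor_inj A B (f g : term A B) :
  Id Unit ⊗ f ≡ Id Unit ⊗ g -> f ≡ g.
Proof.
move=> e; rewrite -[f]eq_id_r -(eq_l_V A) -eq_assoc -eq_l_nat e eq_l_nat.
by rewrite eq_assoc eq_l_V eq_id_r.
Qed.

Lemma tensor_unit_inj A B (f g : term A B) :
  f ⊗ Id Unit ≡ g ⊗ Id Unit -> f ≡ g.
Proof.
move=> e; rewrite -[f]eq_id_r -(eq_r_V A) -eq_assoc -eq_r_nat e eq_r_nat.
by rewrite eq_assoc eq_r_V eq_id_r.
Qed.

(** Kelly's redundant coherence equation. Since [Unit ⊗ -] is faithful, it is
    enough to compare after tensoring with [Unit]; there the pentagon at
    [Unit, Unit, A, B] and two triangles give it, after cancelling the
    associativities on the right. *)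
Lemma unitL_tensor A B : UnitL (A ⊗ B) ∘ Assoc Unit A B ≡ UnitL A ⊗ Id B.
Proof.
apply: unit_tensor_inj.
apply: (epi_cancel (eq_a_V Unit (Unit ⊗ A) B)).
apply: (@epi_cancel _ _ _ _ _ (Assoc Unit Unit A ⊗ Id B)
          (AssocV Unit Unit A ⊗ Id B)).
  by rewrite tensor_compl eq_a_V eq_tensor_id.
rewrite -tensor_compr !eq_assoc -[X in _ ∘ X]eq_assoc -eq_pentagon.
rewrite (comp_pre _ (eq_triangle _ _)) -eq_tensor_id -eq_a_nat.
rewrite (comp_pre _ (symmetry (eq_a_nat _ _ _))) eq_assoc.
by rewrite tensor_compl eq_triangle.
Qed.

(** * Mac Lane coherence *)

Fixpoint pure A B (f : term A B) : bool :=
  match f with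
  | PsiL _ _ _ | PsiR _ _ _ | ApMap _ _ _ _ => false
  | Comp _ _ _ g f => pure g && pure f
  | TensorMap _ _ _ _ f g => pure f && pure g
  | _ => true
  end.

(** A formula acts on formulae by prepending its letters, where each [Ap i B]
    inside it counts as a letter too. With this accumulator, the two sides of
    [Assoc], and those of [UnitL] and [UnitR], act by convertible functions. *)
Fixpoint nf A (n : formula) : formula :=
  match A with
  | Unit => n
  | B ⊗ C => nf B (nf C n)
  | A => A ⊗ n
  end%form.

Fixpoint norm A n : term (A ⊗ n) (nf A n) :=
  match A with
  | Unit => UnitL n
  | Tensor B C => norm B (nf C n) ∘ (Id B ⊗ norm C n) ∘ Assoc B C n
  | Letter p => Id _
  | Ap i B => Id _
  end.

Fixpoint normV A n : term (nf A n) (A ⊗ n) :=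
  match A with
  | Unit => UnitLV n
  | Tensor B C => AssocV B C n ∘ (Id B ⊗ normV C n) ∘ normV B (nf C n)
  | Letter p => Id _
  | Ap i B => Id _
  end.

Lemma pure_norm A n : pure (norm A n).
Proof. by elim: A n => //= B IHB C IHC n; rewrite IHB IHC. Qed.

Lemma pure_normV A n : pure (normV A n).
Proof. by elim: A n => //= B IHB C IHC n; rewrite IHB IHC. Qed.

Lemma normVK A n : normV A n ∘ norm A n ≡ Id (A ⊗ n).
Proof.
elim: A n => [p||B IHB C IHC|i B _] n //=; rewrite ?eq_id_l ?eq_V_l //.
rewrite !eq_assoc (comp_cancel _ (IHB _)).
by rewrite -[X in _ ∘ X]eq_assoc tensor_compr IHC eq_tensor_id eq_id_l eq_V_a.
Qed.

(** Arrows that relate formulae with provably equal normal forms have to be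
    compared across that equality, hence the need to see it as an arrow. *)
Definition idc A B (e : A = B) : term A B := eq_rect A (term A) (Id A) B e.

(** Two proofs that the normal forms of [A] and [B] agree may come from two
    different terms; faithfulness depends on their acting as the same arrow. *)
Lemma idc_irr A B (e e' : A = B) : idc e = idc e'.
Proof. by rewrite (proof_irrelevance _ e e'). Qed.

Lemma pure_idc A B (e : A = B) : pure (idc e).
Proof. by case: B / e. Qed.

Lemma norm_idc A m n (e : m = n) :
  exists e', norm A n ∘ (Id A ⊗ idc e) ≡ idc e' ∘ norm A m.
Proof.
by case: n / e; exists erefl; rewrite /= eq_tensor_id eq_id_l eq_id_r.
Qed.

Lemma idc_comp A B C (e : A = B) (e' : B = C) :
  exists e'', idc e' ∘ idc e ≡ idc e''.
Proof. by case: C / e'; exists e; rewrite /= eq_id_l. Qed.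

Lemma idcV A B (e : A = B) : exists e', idc e' ∘ idc e ≡ Id A.
Proof. by case: B / e; exists erefl; rewrite /= eq_id_l. Qed.

Definition norm_natural A B (f : term A B) : Prop :=
  forall n, exists e : nf A n = nf B n,
    norm B n ∘ (f ⊗ Id n) ≡ idc e ∘ norm A n.

Lemma norm_natural_inv A B (f : term A B) (g : term B A) :
  f ∘ g ≡ Id B -> norm_natural f -> norm_natural g.
Proof.
move=> fg f_nat n; have [e h] := f_nat n; have [e' h'] := idcV e; exists e'.
have gn : (f ⊗ Id n) ∘ (g ⊗ Id n) ≡ Id _.
  by rewrite tensor_compl fg eq_tensor_id.
rewrite -[norm B n]eq_id_r -gn -[X in _ ≡ _ ∘ X]eq_assoc h.
by rewrite -!eq_assoc h' eq_id_l.
Qed.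

Lemma norm_natural_a A B C : norm_natural (Assoc A B C).
Proof.
move=> n; exists erefl; rewrite /= eq_id_l -!tensor_compr !eq_assoc.
rewrite -[Id (A ⊗ B)]eq_tensor_id (comp_pre _ (eq_a_nat _ _ _)) eq_assoc.
by rewrite eq_pentagon !eq_assoc.
Qed.

Lemma norm_natural_l A : norm_natural (UnitL A).
Proof.
move=> n; exists erefl; rewrite /= eq_id_l -unitL_tensor.
by rewrite eq_l_nat eq_assoc.
Qed.

Lemma norm_natural_r A : norm_natural (UnitR A).
Proof. by move=> n; exists erefl; rewrite /= eq_id_l eq_assoc eq_triangle. Qed.

(** The normalization isomorphisms are natural in structural arrows, on whose
    normal forms these arrows act as identities. *)
Lemma pure_natural A B (f : term A B) : pure f -> norm_natural f.
Proof.
elim: A B / f => //=.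
- by move=> A _ n; exists erefl; rewrite eq_tensor_id eq_id_r eq_id_l.
- by move=> A B C _; apply: norm_natural_a.
- move=> A B C _.
  exact: norm_natural_inv (eq_a_V _ _ _) (norm_natural_a _ _ _).
- by move=> A _; apply: norm_natural_l.
- by move=> A _; exact: norm_natural_inv (eq_l_V _) (norm_natural_l _).
- by move=> A _; apply: norm_natural_r.
- by move=> A _; exact: norm_natural_inv (eq_r_V _) (norm_natural_r _).
- move=> A B C g IHg f IHf /andP[/IHg g_nat /IHf f_nat] n.
  have [eg hg] := g_nat n; have [ef hf] := f_nat n.
  have [e he] := idc_comp ef eg; exists e.
  by rewrite -tensor_compl -eq_assoc hg eq_assoc hf -eq_assoc he.
- move=> A A' B B' f IHf g IHg /andP[/IHf f_nat /IHg g_nat] n.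
  have [eg hg] := g_nat n; have [ef hf] := f_nat (nf B n).
  have [e1 h1] := norm_idc A' eg.
  have [e he] := idc_comp ef e1; exists e.
  rewrite /= !eq_assoc eq_a_nat -he.
  rewrite (comp_pre _ (symmetry (eq_tensor_comp _ _ _ _))) hg eq_id_l.
  rewrite -{1}[f]eq_id_l eq_tensor_comp eq_assoc (comp_pre _ h1) -tensor_lr.
  by rewrite /= !eq_assoc (comp_pre _ hf) !eq_assoc.
Qed.

(** Naturality of [norm] expresses [f ⊗ Id Unit] by normalization isomorphisms
    that depend only on [A] and [B]. *)
Lemma coherence A B (f g : term A B) : pure f -> pure g -> f ≡ g.
Proof.
move=> /pure_natural/(_ Unit)[e he] /pure_natural/(_ Unit)[e' he'].
apply: tensor_unit_inj.
rewrite -[f ⊗ _]eq_id_l -[g ⊗ _]eq_id_l -(normVK B Unit).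
by rewrite !eq_assoc he he' (idc_irr e e').
Qed.

(** * Cutting an arrow at a tensor product *)

Definition atom : Type := letter + index * formula.

Definition atom_formula (x : atom) : formula :=
  match x with inl p => Letter p | inr (i, A) => Ap i A end.

Fixpoint flat A : seq atom :=
  match A with
  | Letter p => [:: inl p]
  | Unit => [::]
  | B ⊗ C => flat B ++ flat C
  | Ap i B => [:: inr (i, B)]
  end%form.

Definition word (s : seq atom) : formula :=
  foldr (fun x B => atom_formula x ⊗ B)%form Unit s.

Lemma flat_word s : flat (word s) = s.
Proof. by elim: s => [|[p|[i A]] s IHs] //=; rewrite IHs. Qed.

Lemma nf_flat A n :
  nf A n = foldr (fun x B => atom_formula x ⊗ B)%form n (flat A).
Proof. by elim: A n => //= B IHB C IHC n; rewrite foldr_cat -IHC -IHB. Qed.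

Lemma pure_flat A B (f : term A B) : pure f -> flat A = flat B.
Proof.
elim: A B / f => //=.
- by move=> A B C; rewrite catA.
- by move=> A B C; rewrite catA.
- by move=> A; rewrite cats0.
- by move=> A; rewrite cats0.
- by move=> A B C g IHg f IHf /andP[/IHg <- /IHf].
- by move=> A A' B B' f IHf g IHg /andP[/IHf -> /IHg ->].
Qed.

(** With [pure_flat], the list of top-level nodes classifies formulae up to
    structural isomorphism, so such isomorphisms are found by comparing
    lists. *)
Lemma flat_pure A B : flat A = flat B -> exists f : term A B, pure f.
Proof.
move=> e; have e' : nf A Unit = nf B Unit by rewrite !nf_flat e.
exists (UnitR B ∘ normV B Unit ∘ idc e' ∘ norm A Unit ∘ UnitRV A).
by rewrite /= pure_normV pure_idc pure_norm.
Qed.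

(** All nodes count, not only those at top level: swallowing makes a node
    disappear from the top level but not from the formula. *)
Fixpoint weight A : nat :=
  match A with
  | Letter _ => 1
  | Unit => 0
  | B ⊗ C => weight B + weight C
  | Ap _ B => (weight B).+1
  end%form.

Lemma weight_term A B (f : term A B) : weight A = weight B.
Proof.
elim: A B / f => /=.
all: try by move=> *; rewrite ?addnA ?addn0 ?addnS.
all: by move=> *; congruence.
Qed.

Lemma weight_flat A :
  weight A = sumn [seq weight (atom_formula x) | x <- flat A].
Proof.
by elim: A => //= [B -> C ->|i B _]; rewrite ?map_cat ?sumn_cat ?addn0.
Qed.

(** Every node has positive weight, so prefixes of a list of nodes are told
    apart by their weights. *)
Lemma prefix_weight (s1 s2 t1 t2 : seq atom) :
  s1 ++ s2 = t1 ++ t2 ->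
  sumn [seq weight (atom_formula x) | x <- s1] =
    sumn [seq weight (atom_formula x) | x <- t1] ->
  s1 = t1 /\ s2 = t2.
Proof.
have w_gt0 x : 0 < weight (atom_formula x) by case: x => [|[]].
elim: s1 t1 => [|x s1 IH] [|y t1] //=.
- by move=> _ /eqP; rewrite eq_sym addn_eq0 eqn0Ngt w_gt0.
- by move=> _ /eqP; rewrite addn_eq0 eqn0Ngt w_gt0.
- by move=> [<- /IH{}IH] /addnI/IH[-> ->].
Qed.

Lemma cat_levi (T : Type) (s1 s2 t1 t2 : seq T) : s1 ++ s2 = t1 ++ t2 ->
  (exists u, t1 = s1 ++ u /\ s2 = u ++ t2) \/
  (exists u, s1 = t1 ++ u /\ t2 = u ++ s2).
Proof.
elim: s1 t1 => [|x s1 IH] [|y t1] /= => [->|->|<-|].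
- by left; exists [::].
- by left; exists (y :: t1).
- by right; exists (x :: s1).
- by move=> [<- /IH[[u [-> ->]]|[u [-> ->]]]]; [left|right]; exists u.
Qed.

(** [B] need not be a tensor product itself: asking for the factorization up
    to a structural isomorphism [d], for all places to cut, is what makes the
    property stable under composition and tensor product. *)
Definition cuts A B (f : term A B) : Prop :=
  forall B1 B2, flat B = flat B1 ++ flat B2 ->
  exists A1 A2 (c : term A (A1 ⊗ A2)) (d : term B (B1 ⊗ B2))
    (f1 : term A1 B1) (f2 : term A2 B2),
    [/\ pure c, pure d & d ∘ f ≡ (f1 ⊗ f2) ∘ c].

Lemma pure_cuts A B (f : term A B) : pure f -> cuts f.
Proof.
move=> pf B1 B2 /(@flat_pure B (B1 ⊗ B2))[d pd].
exists B1, B2, (d ∘ f), d, (Id B1), (Id B2); split=> //=; first by rewrite pd.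
by rewrite eq_tensor_id eq_id_l.
Qed.

(** A single node can only be cut off on one side, the other side being
    structurally isomorphic to the unit; such a cut of the target comes from
    the same trivial cut of the source. *)
Lemma ap_cuts A i B (f : term A (Ap i B)) : cuts f.
Proof.
move=> B1 B2 /=; case E1: (flat B1) => [|x s] /= e.
  have [d1 p1] : exists d1 : term Unit B1, pure d1.
    by apply: flat_pure; rewrite E1.
  have [d2 p2] : exists d2 : term (Ap i B) B2, pure d2.
    by apply: flat_pure; rewrite -e.
  exists Unit, A, (UnitLV A), ((d1 ⊗ d2) ∘ UnitLV _), d1, (d2 ∘ f).
  split=> //=; first by rewrite p1 p2.
  by rewrite eq_assoc lV_nat -eq_assoc -eq_tensor_comp eq_id_r.
case: s E1 e => [|? ?] E1 [e1 e2]; last by [].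
have [d1 p1] : exists d1 : term (Ap i B) B1, pure d1.
  by apply: flat_pure; rewrite E1 -e1.
have [d2 p2] : exists d2 : term Unit B2, pure d2.
  by apply: flat_pure; rewrite -e2.
exists A, Unit, (UnitRV A), ((d1 ⊗ d2) ∘ UnitRV _), (d1 ∘ f), d2.
split=> //=; first by rewrite p1 p2.
by rewrite eq_assoc rV_nat -eq_assoc -eq_tensor_comp eq_id_r.
Qed.

Lemma comp_cuts A B C (g : term B C) (f : term A B) :
  cuts g -> cuts f -> cuts (g ∘ f).
Proof.
move=> cut_g cut_f C1 C2 /cut_g[B1 [B2 [c [d [g1 [g2 [pc pd eg]]]]]]].
have [A1 [A2 [c' [d' [f1 [f2 [pc' pd' ef]]]]]]] := cut_f B1 B2 (pure_flat pc).
exists A1, A2, c', d, (g1 ∘ f1), (g2 ∘ f2); split=> //.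
by rewrite -eq_assoc eg eq_assoc (coherence pc pd') ef -eq_assoc eq_tensor_comp.
Qed.

(** A cut of [B ⊗ B'] falls inside [B'] (first case) or inside [B] (second
    case). The nodes [u] lie between that cut and the tensor sign. *)
Lemma tensor_cuts A A' B B' (f : term A B) (g : term A' B') :
  cuts f -> cuts g -> cuts (f ⊗ g).
Proof.
move=> cut_f cut_g B1 B2 /= /cat_levi[[u [e1 e2]]|[u [e1 e2]]].
- have := cut_g (word u) B2; rewrite flat_word => /(_ e2).
  move=> [A1 [A2 [c [d [g1 [g2 [pc pd eg]]]]]]].
  have [p pp] : exists p : term (B ⊗ word u) B1, pure p.
    by apply: flat_pure; rewrite /= flat_word.
  exists (A ⊗ A1)%form, A2, (AssocV _ _ _ ∘ (Id A ⊗ c)).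
  exists ((p ⊗ Id B2) ∘ AssocV _ _ _ ∘ (Id B ⊗ d)), (p ∘ (f ⊗ g1)), g2.
  split=> //=; first by rewrite pp pd.
  rewrite !eq_assoc -eq_tensor_comp eq_id_l eg -[f]eq_id_r eq_tensor_comp.
  rewrite (comp_pre _ (aV_nat _ _ _)) -!eq_assoc.
  by rewrite -eq_tensor_comp eq_id_l eq_id_r.
- have := cut_f B1 (word u); rewrite flat_word => /(_ e1).
  move=> [A1 [A2 [c [d [f1 [f2 [pc pd ef]]]]]]].
  have [p pp] : exists p : term (word u ⊗ B') B2, pure p.
    by apply: flat_pure; rewrite /= flat_word.
  exists A1, (A2 ⊗ A')%form, (Assoc _ _ _ ∘ (c ⊗ Id A')).
  exists ((Id B1 ⊗ p) ∘ Assoc _ _ _ ∘ (d ⊗ Id B')), f1, (p ∘ (f2 ⊗ g)).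
  split=> /=; [by rewrite pc | by rewrite pp pd | ].
  rewrite !eq_assoc -eq_tensor_comp eq_id_l ef -[g]eq_id_r eq_tensor_comp.
  rewrite (comp_pre _ (eq_a_nat _ _ _)) -!eq_assoc.
  by rewrite -eq_tensor_comp eq_id_l eq_id_r.
Qed.

Lemma term_cuts A B (f : term A B) : cuts f.
Proof.
elim: A B / f => *; try (by apply: pure_cuts); try (by apply: ap_cuts).
- exact: comp_cuts.
- exact: tensor_cuts.
Qed.

(** * Arrows of [Fun] in the image of [G] *)

Lemma Gmap_surj A B (f : term A B) (y : 'I_(Gobj B)) : exists x, Gmap f x = y.
Proof.
have cast_surj m n (e : m = n) (z : 'I_n) : exists x, fun_cast e x = z.
  by exists (cast_ord (esym e) z); rewrite fun_castE cast_ordKV.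
elim: A B / f y; try by move=> *; apply: cast_surj.
- by move=> A y; exists y; rewrite /= fun_idE.
- move=> i A B /= y; case: (unliftP ord0 y) => [{}y ->|->].
    case: (split_ordP y) => {}y ->.
  + by exists (lshift _ y); rewrite fun_simpl.
  + by exists (rshift _ (lift ord0 y)); rewrite fun_simpl.
  + by exists (rshift _ ord0); rewrite fun_simpl.
- move=> A B C g IHg f IHf y; have [z <-] := IHg y; have [x <-] := IHf z.
  by exists x; rewrite /= fun_compE.
- move=> A A' B B' f IHf g IHg /= y; split_ord y.
    by have [x <-] := IHf y; exists (lshift _ x); rewrite fun_simpl.
  by have [x <-] := IHg y; exists (rshift _ x); rewrite fun_simpl.
- move=> i A B f IHf /= y; split_ord y; last by exists ord0; rewrite fun_simpl.
  by have [x <-] := IHf y; exists (lift ord0 x); rewrite fun_simpl.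
Qed.

Lemma Gmap_epi A B n (f : term A B) (u v : {ffun 'I_(Gobj B) -> 'I_n}) :
  fun_comp u (Gmap f) = fun_comp v (Gmap f) -> u = v.
Proof.
move=> e; apply/ffunP => y; have [x <-] := Gmap_surj f y.
by rewrite -!fun_compE e.
Qed.

Lemma fun_sum_inj m m' n n' (f f' : {ffun 'I_m -> 'I_m'})
    (g g' : {ffun 'I_n -> 'I_n'}) :
  fun_sum f g = fun_sum f' g' -> f = f' /\ g = g'.
Proof.
move=> /ffunP e; split; apply/ffunP => k.
- by have := e (lshift _ k); rewrite !fun_sum_lshift => /lshift_inj.
- by have := e (rshift _ k); rewrite !fun_sum_rshift => /rshift_inj.
Qed.

Lemma fun_succ_inj m n (f g : {ffun 'I_m -> 'I_n}) :
  fun_succ f = fun_succ g -> f = g.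
Proof.
move=> /ffunP e; apply/ffunP => k; have := e (lift ord0 k).
by rewrite !fun_succS => /lift_inj.
Qed.

(** There is no function from a nonempty ordinal to [0], so no functor occurs
    anywhere along [f]. *)
Lemma Gobj0_pure A B (f : term A B) : Gobj B = 0 -> pure f.
Proof.
elim: A B / f => //=.
- move=> A B C g IHg f IHf C0; rewrite (IHg C0) IHf //.
  by case: (Gobj B) (Gmap g) => // n h; case: (h ord0); rewrite C0.
- move=> A A' B B' f IHf g IHg /eqP.
  by rewrite addn_eq0 => /andP[/eqP/IHf-> /eqP/IHg->].
Qed.

(** * Pulling a functor to the outside *)

Record pulled A := Pulled {
  pulled_index : index;
  pulled_rest : formula;
  pulled_arrow : term A (Ap pulled_index pulled_rest)
}.

Definition pulledL A B (p : pulled A) : pulled (A ⊗ B) :=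
  Pulled (PsiL _ _ B ∘ (pulled_arrow p ⊗ Id B)).

Definition pulledR A B (p : pulled B) : pulled (A ⊗ B) :=
  Pulled (PsiR _ A _ ∘ (Id A ⊗ pulled_arrow p)).

(** The functor numbered [k], if none is above it, swallows its neighbours one
    after the other until it is outermost. A functor below another one cannot
    get out, whence the option. *)
Fixpoint pull A : 'I_(Gobj A) -> option (pulled A) :=
  match A return 'I_(Gobj A) -> option (pulled A) with
  | B ⊗ C => fun k =>
      match split k with
      | inl i => omap (@pulledL B C) (pull i)
      | inr j => omap (@pulledR B C) (pull j)
      end
  | Ap i B => fun k =>
      if unlift ord0 k is Some _ then None else Some (Pulled (Id (Ap i B)))
  | _ => fun _ => None
  end%form.

Lemma pull_lshift A B (i : 'I_(Gobj A)) :
  @pull (A ⊗ B) (lshift _ i) = omap (@pulledL A B) (pull i).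
Proof. by rewrite /= (unsplitK (inl i)). Qed.

Lemma pull_rshift A B (j : 'I_(Gobj B)) :
  @pull (A ⊗ B) (rshift _ j) = omap (@pulledR A B) (pull j).
Proof. by rewrite /= (unsplitK (inr j)). Qed.

Lemma pull_ap0 i A : @pull (Ap i A) ord0 = Some (Pulled (Id _)).
Proof. by rewrite /= unlift_none. Qed.

Lemma pull_apS i A k : @pull (Ap i A) (lift ord0 k) = None.
Proof. by rewrite /= liftK. Qed.

(** A commutative square from [p] to [q] over [f]. The two functors carry
    indices that are only provably equal, hence the equation [e] and the
    arrow [idc]. *)
Definition lifts A B (f : term A B) (p : pulled A) (q : pulled B) : Prop :=
  exists (e : pulled_index p = pulled_index q)
         (f' : term (pulled_rest p) (pulled_rest q)),
    pulled_arrow q ∘ f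
    ≡ idc (congr1 (fun i => Ap i (pulled_rest q)) e) ∘ ApMap _ f'
      ∘ pulled_arrow p.

Lemma lifts_intro i A A' B B' (f : term A B) (s : term A (Ap i A'))
    (t : term B (Ap i B')) (f' : term A' B') :
  t ∘ f ≡ ApMap i f' ∘ s -> lifts f (Pulled s) (Pulled t).
Proof. by move=> e; exists erefl, f'; rewrite /= eq_id_l. Qed.

(** The same square with the equation between the indices eliminated, for use
    when both [p] and [q] are arbitrary. *)
Variant lifts_spec A B (f : term A B) : pulled A -> pulled B -> Prop :=
  LiftsSpec i A' B' (s : term A (Ap i A')) (t : term B (Ap i B'))
      (f' : term A' B') of
    t ∘ f ≡ ApMap i f' ∘ s : lifts_spec f (Pulled s) (Pulled t).

Lemma liftsP A B (f : term A B) p q : lifts f p q -> lifts_spec f p q.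
Proof.
case: p q => [i A' s] [j B' t] [/= e]; case: j / e t => t [f' ef].
by apply: (LiftsSpec (f' := f')); rewrite ef /= eq_id_l.
Qed.

Lemma lifts_comp A B C (g : term B C) (f : term A B) p q r :
  lifts g q r -> lifts f p q -> lifts (g ∘ f) p r.
Proof.
move=> /liftsP[i B' C' t u g' eg]; case: p => [j A' s] [/= e].
case: i / e B' C' t u g' eg => B' C' t u g' eg [f' ef].
apply: (lifts_intro (f' := g' ∘ f')).
by rewrite -eq_assoc eg eq_assoc ef eq_ap_comp eq_id_l eq_assoc.
Qed.

(** Only functors that are free to move in the target are considered, and the
    corresponding functor of the source is then free as well. The converse
    fails: [PsiL] and [PsiR] put functors into the scope of another. *)
Definition pull_natural A B (f : term A B) : Prop :=
  forall k q, pull (Gmap f k) = Some q ->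
  exists2 p, pull k = Some p & lifts f p q.

Lemma lifts_tensorl A A' B B' (f : term A B) (g : term A' B') p q :
  lifts f p q -> lifts (f ⊗ g) (pulledL A' p) (pulledL B' q).
Proof.
case/liftsP=> i C D s t f' ef; apply: (lifts_intro (f' := f' ⊗ g)) => /=.
rewrite eq_assoc -eq_tensor_comp ef eq_id_l.
rewrite -[g in X in X ≡ _]eq_id_r eq_tensor_comp.
by rewrite -!eq_assoc eq_psiL_nat.
Qed.

Lemma lifts_tensorr A A' B B' (f : term A B) (g : term A' B') p q :
  lifts g p q -> lifts (f ⊗ g) (pulledR A p) (pulledR B q).
Proof.
case/liftsP=> i C D s t g' eg; apply: (lifts_intro (f' := f ⊗ g')) => /=.
rewrite eq_assoc -eq_tensor_comp eg eq_id_l.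
rewrite -[f in X in X ≡ _]eq_id_r eq_tensor_comp.
by rewrite -!eq_assoc eq_psiR_nat.
Qed.

Lemma lifts_id A p : lifts (Id A) p p.
Proof.
case: p => i A' s; apply: (lifts_intro (f' := Id A')).
by rewrite eq_ap_id eq_id_l eq_id_r.
Qed.

Definition lifts_iso A B (f : term A B) (g : term B A)
    (p : pulled A) (q : pulled B) : Prop :=
  lifts f p q /\ lifts g q p.

(** A square over an isomorphism whose upper side is invertible can be read
    backwards, which covers the inverses of [a], [l] and [r]. *)
Lemma lifts_iso_intro i A A' B B' (f : term A B) (g : term B A)
    (s : term A (Ap i A')) (t : term B (Ap i B')) (f' : term A' B')
    (g' : term B' A') :
  f ∘ g ≡ Id B -> g' ∘ f' ≡ Id A' ->
  t ∘ f ≡ ApMap i f' ∘ s -> lifts_iso f g (Pulled s) (Pulled t).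
Proof.
move=> fg gf e; split; first exact: lifts_intro e.
apply: (lifts_intro (f' := g')); apply: symmetry.
rewrite -{1}[t]eq_id_r -fg -[X in _ ∘ X ≡ _]eq_assoc e !eq_assoc.
by rewrite -eq_assoc -eq_ap_comp gf eq_ap_id eq_id_l.
Qed.

(** The equations of locally monoidal endofunctors are exactly what naturality
    along [a], [l] and [r] requires: one for each position of the moving
    functor. *)
Lemma lifts_a_left A B C p :
  lifts_iso (Assoc A B C) (AssocV A B C)
    (pulledL C (pulledL B p)) (pulledL (B ⊗ C) p).
Proof.
case: p => i A' s.
apply: (lifts_iso_intro (eq_a_V _ _ _) (eq_V_a _ _ _)) => /=.
rewrite -tensor_compl -!eq_assoc eq_psiL_a !eq_assoc.
by rewrite eq_a_nat eq_tensor_id.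
Qed.

Lemma lifts_a_middle A B C p :
  lifts_iso (Assoc A B C) (AssocV A B C)
    (pulledL C (pulledR A p)) (pulledR A (pulledL C p)).
Proof.
case: p => i B' s.
apply: (lifts_iso_intro (eq_a_V _ _ _) (eq_V_a _ _ _)) => /=.
rewrite -tensor_compl -tensor_compr -!eq_assoc eq_psi_a !eq_assoc.
by rewrite eq_a_nat.
Qed.

Lemma lifts_a_right A B C p :
  lifts_iso (Assoc A B C) (AssocV A B C)
    (pulledR (A ⊗ B) p) (pulledR A (pulledR B p)).
Proof.
case: p => i C' s.
apply: (lifts_iso_intro (eq_a_V _ _ _) (eq_V_a _ _ _)) => /=.
rewrite -tensor_compr -!eq_assoc eq_psiR_a !eq_assoc.
by rewrite -eq_a_nat eq_tensor_id.
Qed.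

Lemma lifts_l A p : lifts_iso (UnitL A) (UnitLV A) (pulledR Unit p) p.
Proof.
case: p => i A' s; apply: (lifts_iso_intro (eq_l_V _) (eq_V_l _)) => /=.
by rewrite -eq_assoc eq_psiR_l eq_l_nat.
Qed.

Lemma lifts_r A p : lifts_iso (UnitR A) (UnitRV A) (pulledL Unit p) p.
Proof.
case: p => i A' s; apply: (lifts_iso_intro (eq_r_V _) (eq_V_r _)) => /=.
by rewrite -eq_assoc eq_psiL_r eq_r_nat.
Qed.

Lemma iso_pull_natural A B (f : term A B) (g : term B A) :
  g ∘ f ≡ Id A ->
  (forall k, match pull k, pull (Gmap f k) with
             | Some p, Some q => lifts_iso f g p q
             | None, None => True
             | _, _ => False
             end) ->
  pull_natural f /\ pull_natural g.
Proof.
move=> gf h; split=> k q.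
  have := h k; case: (pull k) => [p|]; case: (pull (Gmap f k)) => // r.
  by move=> [fpr _] [<-]; exists p.
have [{}k <-] := Gmap_surj f k.
have /= -> : Gmap g (Gmap f k) = k.
  by rewrite -fun_compE -[fun_comp _ _]/(Gmap (g ∘ f)) (Gmap_eqv gf) fun_idE.
have := h k; case: (pull k) => [p|] //; case: (pull (Gmap f k)) => // r.
by move=> [_ grp] [<-]; exists r.
Qed.

Lemma pull_natural_a A B C :
  pull_natural (Assoc A B C) /\ pull_natural (AssocV A B C).
Proof.
apply: (iso_pull_natural (eq_V_a _ _ _)) => k; rewrite [Gmap _]/=; cbn in k.
split_ord k; rewrite !fun_simpl !(pull_lshift, pull_rshift);
  case: (pull k) => //= p.
- exact: lifts_a_left.
- exact: lifts_a_middle.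
- exact: lifts_a_right.
Qed.

Lemma pull_natural_l A : pull_natural (UnitL A) /\ pull_natural (UnitLV A).
Proof.
apply: (iso_pull_natural (eq_V_l _)) => k; rewrite [Gmap _]/=; cbn in k.
split_ord k; rewrite !fun_simpl pull_rshift; case: (pull k) => //= p.
exact: lifts_l.
Qed.

Lemma pull_natural_r A : pull_natural (UnitR A) /\ pull_natural (UnitRV A).
Proof.
apply: (iso_pull_natural (eq_V_r _)) => k; rewrite [Gmap _]/=; cbn in k.
split_ord k; rewrite !fun_simpl pull_lshift; case: (pull k) => //= p.
exact: lifts_r.
Qed.

Lemma pull_natural_psiL i A B : pull_natural (PsiL i A B).
Proof.
move=> k q; rewrite [Gmap _]/=; cbn in k; case: (split_ordP k) => {}k ->.
  case: (unliftP ord0 k) => [{}k ->|->];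
    rewrite fun_simpl ?cast_addSnS ?cast_addSn0.
    by rewrite pull_apS.
  rewrite pull_ap0 pull_lshift pull_ap0 => -[<-]; eexists; first by [].
  apply: (lifts_intro (f' := Id _)) => /=.
  by rewrite eq_tensor_id eq_ap_id eq_id_r.
by rewrite fun_simpl cast_addSnR pull_apS.
Qed.

Lemma pull_natural_psiR i A B : pull_natural (PsiR i A B).
Proof.
move=> k q; rewrite [Gmap _]/=; cbn in k; case: (split_ordP k) => {}k ->.
  by rewrite fun_simpl pull_apS.
case: (unliftP ord0 k) => [{}k ->|->]; rewrite fun_simpl;
  first by rewrite pull_apS.
rewrite pull_ap0 pull_rshift pull_ap0 => -[<-]; eexists; first by [].
apply: (lifts_intro (f' := Id _)) => /=.
by rewrite eq_tensor_id eq_ap_id eq_id_r.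
Qed.

Lemma pull_natural_tensor A A' B B' (f : term A B) (g : term A' B') :
  pull_natural f -> pull_natural g -> pull_natural (f ⊗ g).
Proof.
move=> f_nat g_nat k q; rewrite [Gmap _]/=; cbn in k;
  split_ord k; rewrite fun_simpl.
- rewrite !pull_lshift; case E: (pull (Gmap f k)) => [r|] //= [<-].
  have [p -> fpr] := f_nat _ _ E; exists (pulledL A' p) => //.
  exact: lifts_tensorl.
- rewrite !pull_rshift; case E: (pull (Gmap g k)) => [r|] //= [<-].
  have [p -> gpr] := g_nat _ _ E; exists (pulledR A p) => //.
  exact: lifts_tensorr.
Qed.

Lemma pull_natural_ap i A B (f : term A B) : pull_natural (ApMap i f).
Proof.
move=> k q; rewrite [Gmap _]/=; cbn in k.
case: (unliftP ord0 k) => [{}k ->|->]; rewrite fun_simpl;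
  first by rewrite pull_apS.
rewrite !pull_ap0 => -[<-]; eexists; first by [].
by apply: (lifts_intro (f' := f)); rewrite eq_id_l eq_id_r.
Qed.

Lemma term_pull_natural A B (f : term A B) : pull_natural f.
Proof.
elim: A B / f.
- by move=> A k q; rewrite /= fun_idE => e; exists q => //; apply: lifts_id.
- by move=> A B C; apply: (pull_natural_a A B C).1.
- by move=> A B C; apply: (pull_natural_a A B C).2.
- by move=> A; apply: (pull_natural_l A).1.
- by move=> A; apply: (pull_natural_l A).2.
- by move=> A; apply: (pull_natural_r A).1.
- by move=> A; apply: (pull_natural_r A).2.
- exact: pull_natural_psiL.
- exact: pull_natural_psiR.
- move=> A B C g IHg f IHf k r; rewrite /= fun_compE.
  move=> /IHg[q /IHf[p E fpq] gqr].
  by exists p => //; apply: lifts_comp gqr fpq.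
- by move=> *; apply: pull_natural_tensor.
- by move=> *; apply: pull_natural_ap.
Qed.

(** Naturality of [pull] at a target whose functor [0] is already outermost,
    where the pulled arrow is the identity. *)
Lemma ap_factor i A B (f g : term A (Ap i B)) : Gmap f = Gmap g ->
  exists A' (s : term A (Ap i A')) (f' g' : term A' B),
    f ≡ ApMap i f' ∘ s /\ g ≡ ApMap i g' ∘ s.
Proof.
move=> efg; have [k fk] := Gmap_surj f ord0.
have [p Ef] : exists2 p, pull k = Some p & lifts f p (Pulled (Id (Ap i B))).
  by apply: term_pull_natural; rewrite fk pull_ap0.
have [p' Eg] : exists2 p, pull k = Some p & lifts g p (Pulled (Id (Ap i B))).
  by apply: term_pull_natural; rewrite -efg fk pull_ap0.
move: Eg; rewrite Ef => -[<-]; case: p {Ef} => j A' s.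
move=> [/= e [g' eg]] [/= e' [f' ef]].
move: eg ef; rewrite (proof_irrelevance _ e' e).
case: i / e f g efg fk e' => f g efg fk _.
rewrite /= !eq_id_l => eg ef.
by exists A', s, f', g'; rewrite ef eg.
Qed.

(** * Faithfulness *)

Lemma Gmap_faithful A B (f g : term A B) : Gmap f = Gmap g -> f ≡ g.
Proof.
have base A0 B0 (f0 g0 : term A0 B0) : Gobj B0 = 0 -> f0 ≡ g0.
  by move=> B0_0; apply: coherence; apply: Gobj0_pure.
elim: B A f g => [p||B IHB C IHC|i B IHB] A f g efg; try exact: base.
  have [A1 [A2 [c [d [f1 [f2 [pc pd ef]]]]]]] :=
    term_cuts f (erefl (flat (B ⊗ C))).
  have [A1' [A2' [c' [d' [g1 [g2 [pc' pd' eg]]]]]]] :=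
    term_cuts g (erefl (flat (B ⊗ C))).
  (* The cut asked for is the tensor sign of the target itself, so the
     structural isomorphisms on the target are identities. *)
  have dI : d ≡ Id _ by exact: coherence.
  have dI' : d' ≡ Id _ by exact: coherence.
  move: ef eg; rewrite dI dI' !eq_id_l => ef eg.
  have e : flat A1 ++ flat A2 = flat A1' ++ flat A2'.
    by rewrite -[LHS](pure_flat pc) (pure_flat pc').
  have [e1 e2] : flat A1 = flat A1' /\ flat A2 = flat A2'.
    apply: prefix_weight e _; rewrite -!weight_flat.
    by rewrite (weight_term f1) (weight_term g1).
  have [q1 pq1] := flat_pure e1; have [q2 pq2] := flat_pure e2.
  have ec : c' ≡ (q1 ⊗ q2) ∘ c.
    by apply: coherence => //=; rewrite pq1 pq2.
  move: eg; rewrite ec -eq_assoc -eq_tensor_comp => eg.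
  move: efg; rewrite (Gmap_eqv ef) (Gmap_eqv eg).
  move=> /Gmap_epi/fun_sum_inj[e1' e2'].
  have ef1 : f1 ≡ g1 ∘ q1 by apply: IHB.
  have ef2 : f2 ≡ g2 ∘ q2 by apply: IHC.
  by rewrite ef eg ef1 ef2.
have [A' [s [f' [g' [ef eg]]]]] := ap_factor efg.
move: efg; rewrite (Gmap_eqv ef) (Gmap_eqv eg) => /Gmap_epi/fun_succ_inj e.
have fg' : f' ≡ g' by apply: IHB.
by rewrite ef eg fg'.
Qed.

End Faithful.

Theorem mainTheorem4 (letter index : Type) : faithful (G letter index).
Proof. by move=> A B f g; apply: Gmap_faithful. Qed.
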